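(* Let $\mathbf f$ be a $k$-ary function symbol of $\mathcal M$, $k\in\{0,1,2\}$, with $\mathbf f\notin\{\times,\div,\mathbf p\}$. Then there exists an existential first-order formula $\psi(x_0,\dots,x_{k-1},y,z)$ of $\mathcal M$ such that for all $d,t\in\omega$ with $d\ge t$ and all $a_0,\dots,a_{k-1},b\in\mathbf M_d$, we have $\mathbf f_{d,t}(a_0,\dots,a_{k-1})=b$ if and only if $\mathbf M_d\models\psi(a_0,\dots,a_{k-1},b,t)$.
   Context: $\mathcal M$ is the first-order language with equality with constant symbols $\mathbf 0,\mathbf 1,-\mathbf 1,\mathbf n$, unary function symbols $\mathcal N,\mathbf p$, and binary function symbols $+,\times,\div,\max,\min,\cap$. For $d\in\omega$ and $n=2^d$, $\mathbf M_d$ has universe $\{0,\dots,2^n-1\}$; $+,\times$ are modulo $2^n$; $\mathbf p(x)=\min\{2^x,2^n-1\}$; $\div(x,y)=\lfloor x/y\rfloor$ for $y\neq0$ and $0$ for $y=0$; constants $\mathbf 0,\mathbf 1,\mathbf n,-\mathbf 1$ denote $0,1,n,2^n-1$; $\max,\min$ usual; $\cap$ bitwise AND and $\mathcal N$ bitwise complement on $n$-bit binary representations. For $a,t\in\omega$ and an integer $i$, $a[i,t]$ denotes the $i$-th digit of $a$ in base $2^{2^t}$ (so $a=\sum_i a[i,t]2^{i2^t}$; $a[i,t]=0$ for $i<0$). For $d\ge t$ and a $k$-ary function symbol $\mathbf f$, the function $\mathbf f_{d,t}$ on $\mathbf M_d$ is defined by: $\mathbf f_{d,t}(a_0,\dots,a_{k-1})$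 is the unique $b\in\mathbf M_d$ such that for all $i<2^{d-t}$, $\mathbf M_t\models\mathbf f(a_0[i,t],\dots,a_{k-1}[i,t])=b[i,t]$ (i.e., $\mathbf f$ is applied componentwise to the vectors of base-$2^{2^t}$ digits). *)

(* Defs.v *)
From mathcomp Require Import all_boot.

Set Implicit Arguments.
Unset Strict Implicit.
Unset Printing Implicit Defensive.

(* The constants 0, 1, -1, n are the nullary function symbols of the language. *)
Inductive symbol : Type :=
  | Zero | One | MinusOne | Len
  | Compl | Pow
  | Add | Mul | Div | Max | Min | Cap.

Definition arity (f : symbol) : nat :=
  match f with
  | Zero | One | MinusOne | Len => 0
  | Compl | Pow => 1
  | Add | Mul | Div | Max | Min | Cap => 2
  end.

(* Terms and formulas whose free variables are among x_0, ..., x_(n-1)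
   (de Bruijn indices: a quantifier binds variable 0 of its body and shifts the
   other variables by one). *)
Inductive term (n : nat) : Type :=
  | Var of 'I_n
  | App (f : symbol) of ('I_(arity f) -> term n).

Inductive formula (n : nat) : Type :=
  | FEq of term n & term n
  | FNot of formula n
  | FAnd of formula n & formula n
  | FOr of formula n & formula n
  | FImp of formula n & formula n
  | FEx of formula n.+1
  | FAll of formula n.+1.

Fixpoint quantifier_free n (phi : formula n) : bool :=
  match phi with
  | FEq _ _ => true
  | FNot p => quantifier_free p
  | FAnd p q | FOr p q | FImp p q => quantifier_free p && quantifier_free q
  | FEx _ | FAll _ => false
  end.

(* A block of existential quantifiers in front of a quantifier-free formula. *)
Fixpoint existential n (phi : formula n) : bool :=
  if phi is FEx p then existential p else quantifier_free phi.

Definition M (d : nat) : finType := 'I_(2 ^ 2 ^ d).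

Lemma M_gt0 d : 0 < 2 ^ 2 ^ d.
Proof. by rewrite expn_gt0. Qed.

Definition inM (d x : nat) : M d := Ordinal (ltn_pmod x (M_gt0 d)).

Definition bit (x i : nat) : bool := odd (x %/ 2 ^ i).

Definition bitand (n x y : nat) : nat :=
  \sum_(i < n) (bit x i && bit y i) * 2 ^ i.

Definition bitcompl (n x : nat) : nat :=
  \sum_(i < n) (~~ bit x i) * 2 ^ i.

Definition op1 d (g : nat -> nat) (a : 1.-tuple (M d)) : M d :=
  inM d (g (tnth a ord0)).

Definition op2 d (g : nat -> nat -> nat) (a : 2.-tuple (M d)) : M d :=
  inM d (g (tnth a ord0) (tnth a ord_max)).

(* The reduction modulo 2 ^ 2 ^ d performed by inM is effective only for Add
   and Mul; the other values are already in range. Note x %/ 0 = 0. *)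
Definition interp (d : nat) (f : symbol) : (arity f).-tuple (M d) -> M d :=
  let n := 2 ^ d in
  match f return (arity f).-tuple (M d) -> M d with
  | Zero => fun=> inM d 0
  | One => fun=> inM d 1
  | MinusOne => fun=> inM d (2 ^ n - 1)
  | Len => fun=> inM d n
  | Compl => op1 (bitcompl n)
  | Pow => op1 (fun x => minn (2 ^ x) (2 ^ n - 1))
  | Add => op2 addn
  | Mul => op2 muln
  | Div => op2 divn
  | Max => op2 maxn
  | Min => op2 minn
  | Cap => op2 (bitand n)
  end.
Arguments interp {d} f a.

Fixpoint eval d n (e : n.-tuple (M d)) (u : term n) : M d :=
  match u with
  | Var i => tnth e i
  | App f args => interp f [tuple eval e (args i) | i < arity f]
  end.

Fixpoint holds d n (e : n.-tuple (M d)) (phi : formula n) : Prop :=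
  match phi with
  | FEq u v => eval e u = eval e v
  | FNot p => ~ holds e p
  | FAnd p q => holds e p /\ holds e q
  | FOr p q => holds e p \/ holds e q
  | FImp p q => holds e p -> holds e q
  | FEx p => exists x : M d, holds [tuple of x :: e] p
  | FAll p => forall x : M d, holds [tuple of x :: e] p
  end.

(* a[i, t], for i >= 0. *)
Definition digit (t a i : nat) : M t := inM t (a %/ 2 ^ (i * 2 ^ t)).

Definition componentwise_spec d t (f : symbol) (a : (arity f).-tuple (M d))
    (b : M d) : bool :=
  [forall i : 'I_(2 ^ (d - t)),
     interp f [tuple digit t (tnth a j) i | j < arity f] == digit t b i].
Arguments componentwise_spec {d} t f a b.

(* f_(d,t)(a) is the unique b satisfying the specification; for t <= d the
   default value is irrelevant by componentwiseP below. *)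
Definition componentwise d t (f : symbol) (a : (arity f).-tuple (M d)) : M d :=
  odflt (inM d 0) [pick b | componentwise_spec t f a b].
Arguments componentwise {d} t f a.

Lemma digits_ub t m (F : nat -> nat) :
  (forall i, F i < 2 ^ 2 ^ t) ->
  \sum_(i < m) F i * 2 ^ (i * 2 ^ t) < 2 ^ (m * 2 ^ t).
Proof.
move=> FP; elim: m => [|m IH]; first by rewrite big_ord0 expn_gt0.
rewrite big_ord_recr /= mulSn expnD.
apply: (@leq_trans (2 ^ (m * 2 ^ t) + F m * 2 ^ (m * 2 ^ t))).
  by rewrite ltn_add2r.
by rewrite -mulSn leq_mul2r FP orbT.
Qed.

Lemma digits_sum t m (F : nat -> nat) i :
  (forall i, F i < 2 ^ 2 ^ t) -> i < m ->
  ((\sum_(j < m) F j * 2 ^ (j * 2 ^ t)) %/ 2 ^ (i * 2 ^ t)) %% 2 ^ 2 ^ t = F i.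
Proof.
elim: m F i => [//|m IH] F i FP.
have -> : \sum_(j < m.+1) F j * 2 ^ (j * 2 ^ t) =
    (\sum_(j < m) F j.+1 * 2 ^ (j * 2 ^ t)) * 2 ^ 2 ^ t + F 0.
  rewrite big_ord_recl mul0n expn0 muln1 addnC big_distrl; congr (_ + _).
  by apply: eq_bigr => j _ /=; rewrite -mulnA -expnD addnC -mulSn.
case: i => [_|i lt_im]; first by rewrite mul0n divn1 modnMDl modn_small.
rewrite mulSn expnD divnMA divnMDl ?expn_gt0 // (divn_small (FP 0)) addn0.
exact: (IH (fun j => F j.+1)).
Qed.

Lemma digits_inj t m x y :
  x < 2 ^ (m * 2 ^ t) -> y < 2 ^ (m * 2 ^ t) ->
  (forall i, i < m -> digit t x i = digit t y i) -> x = y.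
Proof.
elim: m x y => [|m IH] x y; first by rewrite mul0n !ltnS !leqn0 => /eqP-> /eqP->.
rewrite mulSn expnD => ltx lty E.
rewrite (divn_eq x (2 ^ 2 ^ t)) (divn_eq y (2 ^ 2 ^ t)).
have /(congr1 val) /= := E 0 isT; rewrite mul0n !divn1 => ->.
congr (_ * _ + _); apply: IH; rewrite ?ltn_divLR ?expn_gt0 1?mulnC //.
move=> i lt_im; apply: val_inj; have /(congr1 val) /= := E i.+1 lt_im.
by rewrite mulSn expnD !divnMA.
Qed.

Lemma componentwiseP d t f (a : (arity f).-tuple (M d)) b :
  t <= d -> reflect (componentwise t f a = b) (componentwise_spec t f a b).
Proof.
move=> le_td.
have Edt : 2 ^ (d - t) * 2 ^ t = 2 ^ d by rewrite -expnD subnK.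
pose F i := val (interp f [tuple digit t (tnth a j) i | j < arity f]).
have FP i : F i < 2 ^ 2 ^ t by apply: ltn_ord.
have spec0 : componentwise_spec t f a
    (inM d (\sum_(i < 2 ^ (d - t)) F i * 2 ^ (i * 2 ^ t))).
  apply/forallP => i; apply/eqP/val_inj => /=.
  by rewrite [X in X %/ _]modn_small ?digits_sum // -Edt digits_ub.
have uniq_spec c c' :
    componentwise_spec t f a c -> componentwise_spec t f a c' -> c = c'.
  move=> /forallP H /forallP H'; apply: val_inj.
  apply: (@digits_inj t (2 ^ (d - t))); rewrite ?Edt ?ltn_ord // => i lt_i.
  by rewrite -(eqP (H (Ordinal lt_i))) -(eqP (H' (Ordinal lt_i))).
have specC : componentwise_spec t f a (componentwise t f a).
  by rewrite /componentwise; case: pickP => //= H; rewrite H in spec0.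
by apply: (iffP idP) => [/(uniq_spec _ _ specC) | <-].
Qed.

Lemma inM_level d t : t <= d -> val (inM d t) = t.
Proof.
move=> le_td; rewrite /= modn_small //; apply: leq_ltn_trans le_td _.
by apply: ltn_trans (ltn_expl d _) (ltn_expl _ _).
Qed.

(* Main.v *)
(** For t = d the function f_(d,t) is f itself.  For t < d it is the value of a
term in the arguments and t, so that the formula can be taken
quantifier-free.  With B = 2 ^ 2 ^ t, the quotient of -1 by B + 1 is a mask
selecting the digits of even index.  After masking, every digit is followed by
a zero digit, which receives the carry of an addition: adding the even and the
odd digits separately gives componentwise addition, and reading off the carries
of a + (B - 1 - b) compares all digits at once.  The comparison bits times
B - 1 form a mask selecting the larger or the smaller digits. *)

Require Import Defs.
From mathcomp Require Import all_boot zify.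

Set Implicit Arguments.
Unset Strict Implicit.
Unset Printing Implicit Defensive.

(** * Bits and the bitwise operations *)

Lemma bit_sum n (F : nat -> bool) i :
  i < n -> bit (\sum_(j < n) F j * 2 ^ j) i = F i.
Proof.
(* Bits are the digits of level 0, where the base is 2 ^ 2 ^ 0 = 2. *)
move=> lt_in; have FP j : F j < 2 ^ 2 ^ 0 by case: (F j).
have := digits_sum FP lt_in; rewrite expn0 muln1 expn1 modn2.
under eq_bigr do rewrite muln1.
by rewrite /bit; case: odd; case: (F i).
Qed.

Lemma bit_sum_lt n (F : nat -> bool) : \sum_(j < n) F j * 2 ^ j < 2 ^ n.
Proof.
have FP j : F j < 2 ^ 2 ^ 0 by case: (F j).
have := digits_ub n FP; rewrite expn0 muln1.
by under eq_bigr do rewrite muln1.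
Qed.

Lemma bit_inj n x y : x < 2 ^ n -> y < 2 ^ n ->
  (forall i, i < n -> bit x i = bit y i) -> x = y.
Proof.
move=> ltx lty E; apply: (@digits_inj 0 n); rewrite ?muln1 // => i /E Ei.
by apply: val_inj; rewrite /= expn0 muln1 expn1 !modn2 -/(bit x i) Ei.
Qed.

Lemma bit_mod n x i : i < n -> bit (x %% 2 ^ n) i = bit x i.
Proof.
move=> lt_in; rewrite [in RHS](divn_eq x (2 ^ n)) /bit.
rewrite -[X in _ * 2 ^ X](subnK lt_in) addnS -addSn expnD mulnA.
by rewrite divnMDl ?expn_gt0 // oddD expnS mulnCA oddM.
Qed.

Lemma bit_div n x i : bit (x %/ 2 ^ n) i = bit x (n + i).
Proof. by rewrite /bit expnD divnMA. Qed.

Lemma sum_bits n x : x < 2 ^ n -> \sum_(i < n) bit x i * 2 ^ i = x.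
Proof.
move=> ltx; apply: (@bit_inj n) => // [|i lt_in]; first exact: bit_sum_lt.
exact: bit_sum.
Qed.

Lemma sum_exp2 n : \sum_(i < n) 2 ^ i = 2 ^ n - 1.
Proof. by rewrite subn1 predn_exp mul1n. Qed.

Lemma bit_ones n i : i < n -> bit (2 ^ n - 1) i.
Proof.
move=> lt_in; rewrite -sum_exp2.
by have := bit_sum predT lt_in; under eq_bigr do rewrite /= mul1n.
Qed.

Lemma bitand_lt n x y : bitand n x y < 2 ^ n.
Proof. exact: (@bit_sum_lt n (fun i => bit x i && bit y i)). Qed.

Lemma bitcompl_lt n x : bitcompl n x < 2 ^ n.
Proof. exact: (@bit_sum_lt n (fun i => ~~ bit x i)). Qed.

Lemma bit_bitand n x y i : i < n -> bit (bitand n x y) i = bit x i && bit y i.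
Proof. exact: (@bit_sum n (fun i => bit x i && bit y i)). Qed.

Lemma bit_bitcompl n x i : i < n -> bit (bitcompl n x) i = ~~ bit x i.
Proof. exact: (@bit_sum n (fun i => ~~ bit x i)). Qed.

Lemma bitand0 n x : bitand n x 0 = 0.
Proof.
by rewrite /bitand big1 // => i _; rewrite /bit div0n andbF.
Qed.

Lemma bitand_ones n x : x < 2 ^ n -> bitand n x (2 ^ n - 1) = x.
Proof.
move=> ltx; apply: (@bit_inj n) => // [|i lt_in]; first exact: bitand_lt.
by rewrite bit_bitand // bit_ones // andbT.
Qed.

(** Adding the bits of [x] to the complementary bits gives the all-ones number, without any
    carry. *)
Lemma bitcomplE n x : x < 2 ^ n -> bitcompl n x = 2 ^ n - 1 - x.
Proof.
move=> ltx; rewrite -sum_exp2 -{2}(sum_bits ltx).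
apply/eqP; rewrite -(eqn_add2r (\sum_(i < n) bit x i * 2 ^ i)) subnK.
  rewrite /bitcompl -big_split /=; apply/eqP; apply: eq_bigr => i _.
  by case: bit; rewrite ?mul1n ?mul0n ?addn0.
by apply: leq_sum => i _; case: bit; rewrite ?mul1n.
Qed.

(** De Morgan form, because the language offers only intersection and complement. *)
Definition bitor n x y := bitcompl n (bitand n (bitcompl n x) (bitcompl n y)).

Lemma bitorC n x y : bitor n x y = bitor n y x.
Proof.
by rewrite /bitor /bitand; under eq_bigr do rewrite andbC.
Qed.

Lemma bitor0 n x : x < 2 ^ n -> bitor n x 0 = x.
Proof.
move=> ltx; rewrite /bitor (@bitcomplE n 0) ?expn_gt0 // subn0.
rewrite bitand_ones ?bitcompl_lt // !bitcomplE //; try lia.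
Qed.

(** * Base 2 ^ 2 ^ t digits and their bits *)

Definition dg t x i := val (digit t x i).

Lemma dg_lt t x i : dg t x i < 2 ^ 2 ^ t.
Proof. exact: ltn_ord. Qed.

Lemma dgE t x i : dg t x i = (x %/ (2 ^ 2 ^ t) ^ i) %% 2 ^ 2 ^ t.
Proof. by rewrite /dg /= -expnM mulnC. Qed.

Lemma bit_dg t x i j : j < 2 ^ t -> bit (dg t x i) j = bit x (i * 2 ^ t + j).
Proof. by move=> ltj; rewrite /dg /= bit_mod // bit_div. Qed.

Lemma exp2_levels d t : t <= d -> 2 ^ 2 ^ d = (2 ^ 2 ^ t) ^ 2 ^ (d - t).
Proof. by move=> le_td; rewrite -expnM -expnD subnKC. Qed.

Lemma expn2_gt1 t : 1 < 2 ^ 2 ^ t.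
Proof. by rewrite -{1}(expn0 2) ltn_exp2l // expn_gt0. Qed.

Section Digits.

Variables (d t : nat) (le_td : t <= d).
Local Notation B := (2 ^ 2 ^ t).
Local Notation m := (2 ^ (d - t)).

Lemma dg_bit_index i j : i < m -> j < 2 ^ t -> i * 2 ^ t + j < 2 ^ d.
Proof.
move=> lti ltj; apply: (@leq_trans (i.+1 * 2 ^ t)).
  by rewrite mulSn addnC ltn_add2r.
by rewrite -[X in _ <= 2 ^ X](subnK le_td) expnD leq_mul2r lti orbT.
Qed.

Lemma dg_bitand x y i : i < m ->
  dg t (bitand (2 ^ d) x y) i = bitand (2 ^ t) (dg t x i) (dg t y i).
Proof.
move=> lti; apply: (@bit_inj (2 ^ t)) => [||j ltj];
  rewrite ?dg_lt ?bitand_lt //.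
by rewrite bit_dg // !bit_bitand ?dg_bit_index // !bit_dg.
Qed.

Lemma dg_bitcompl x i : i < m ->
  dg t (bitcompl (2 ^ d) x) i = bitcompl (2 ^ t) (dg t x i).
Proof.
move=> lti; apply: (@bit_inj (2 ^ t)) => [||j ltj];
  rewrite ?dg_lt ?bitcompl_lt //.
by rewrite bit_dg // !bit_bitcompl ?dg_bit_index // bit_dg.
Qed.

(** The modulus is B ^ m, so the reduction only drops digits from position m on. *)
Lemma dg_mod x i : i < m -> dg t (x %% 2 ^ 2 ^ d) i = dg t x i.
Proof.
move=> lti; rewrite !dgE {2}(divn_eq x (2 ^ 2 ^ d)) (exp2_levels le_td).
rewrite -[X in _ * _ ^ X](subnK lti) addnS -addSn expnD mulnA.
rewrite divnMDl ?expn_gt0 //.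
by rewrite expnS mulnCA mulnC modnMDl.
Qed.

Lemma dg_out x i : x < 2 ^ 2 ^ d -> m <= i -> dg t x i = 0.
Proof.
move=> ltx le_mi; rewrite dgE divn_small ?mod0n //; apply: leq_trans ltx _.
by rewrite (exp2_levels le_td) leq_exp2l // expn2_gt1.
Qed.

End Digits.

(** * Carries, scaling and masks in base B *)

Section LevelDigits.

Variable t : nat.
Local Notation B := (2 ^ 2 ^ t).

Lemma dg_div x i : dg t (x %/ B) i = dg t x i.+1.
Proof. by rewrite !dgE expnS divnMA. Qed.

Lemma dg_sum (F : nat -> nat) m i : (forall i, F i < B) -> i < m ->
  dg t (\sum_(j < m) F j * B ^ j) i = F i.
Proof.
move=> FP lti; rewrite -(digits_sum FP lti) /dg /=.
by under eq_bigr do rewrite -expnM [2 ^ t * _]mulnC.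
Qed.

Lemma modn_exp_dg0 x i : dg t x i = 0 -> x %% B ^ i.+1 = x %% B ^ i.
Proof.
rewrite dgE => x0.
rewrite {1}(divn_eq x (B ^ i)) {1}(divn_eq (x %/ B ^ i) B) x0.
rewrite addn0 -mulnA -expnS modnMDl modn_small //.
apply: leq_trans (ltn_pmod _ _) _; first by rewrite !expn_gt0.
by rewrite leq_exp2l ?expn2_gt1.
Qed.

(* A zero digit just below position i absorbs the carry arriving there. *)
Lemma divn_exp_add x y i :
  (forall k, i = k.+1 -> dg t x k = 0 /\ dg t y k = 0) ->
  (x + y) %/ B ^ i = x %/ B ^ i + y %/ B ^ i.
Proof.
case: i => [|i] H; first by rewrite expn0 !divn1.
have [x0 y0] := H _ erefl.
have p : 0 < B ^ i by rewrite !expn_gt0.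
have p' : 0 < B ^ i.+1 by rewrite !expn_gt0.
rewrite divnD // !modn_exp_dg0 //.
(* Both remainders are below B ^ i, and 2 B ^ i <= B ^ (i + 1) since B >= 2. *)
suff -> : (B ^ i.+1 <= x %% B ^ i + y %% B ^ i) = false by rewrite addn0.
apply/negbTE; rewrite -ltnNge expnS.
have := ltn_pmod x p; have := ltn_pmod y p; have := expn2_gt1 t.
nia.
Qed.

Lemma dg_add x y i :
  (forall k, i = k.+1 -> dg t x k = 0 /\ dg t y k = 0) ->
  dg t (x + y) i = (dg t x i + dg t y i) %% B.
Proof. by move=> H; rewrite !dgE divn_exp_add // modnDm. Qed.

Lemma dg_carry x y i :
  (forall k, i = k.+1 -> dg t x k = 0 /\ dg t y k = 0) ->
  dg t x i.+1 = 0 -> dg t y i.+1 = 0 ->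
  dg t (x + y) i.+1 = (dg t x i + dg t y i) %/ B.
Proof.
move=> H; rewrite !dgE expnSr !divnMA divn_exp_add // => x0 y0.
have B0 : 0 < B by rewrite expn_gt0.
set X := x %/ _ in x0 *; set Y := y %/ _ in y0 *.
rewrite divnD // -addnA -modnDm x0 add0n modn_mod -modnDm y0 add0n modn_mod.
(* The same division formula, applied to the two digits alone, identifies the carry bit with the
   quotient of their sum by B. *)
have := divnD (X %% B) (Y %% B) B0.
rewrite !modn_mod !(divn_small (ltn_pmod _ B0)) => ->.
rewrite !add0n modn_small //.
by apply: leq_ltn_trans (leq_b1 _) (expn2_gt1 t).
Qed.

(** As no scaled digit reaches B, the part of [x] below position i stays below B ^ i after scaling,
    and nothing is carried. *)
Lemma dg_scale k x i :
  (forall j, k * dg t x j < B) -> dg t (k * x) i = k * dg t x i.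
Proof.
move=> H; have lt_mod : k * (x %% B ^ i) < B ^ i.
  elim: i => [|i IH]; first by rewrite expn0 modn1 muln0.
  have -> : x %% B ^ i.+1 = dg t x i * B ^ i + x %% B ^ i.
    rewrite {1}(divn_eq x (B ^ i)) {1}(divn_eq (x %/ B ^ i) B) -dgE.
    rewrite mulnDl -mulnA -expnS -addnA modnMDl modn_small //.
    have p : 0 < B ^ i by rewrite !expn_gt0.
    have := ltn_pmod x p; have := dg_lt t x i; rewrite expnS; nia.
  by have := H i; rewrite expnS; nia.
rewrite dgE {1}(divn_eq x (B ^ i)) mulnDr mulnA divnMDl ?expn_gt0 //.
by rewrite (divn_small lt_mod) addn0 -modnMmr -dgE modn_small.
Qed.

Lemma expn_sub1_sum m : B ^ m - 1 = \sum_(j < m) (B - 1) * B ^ j.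
Proof. by rewrite subn1 predn_exp -subn1 big_distrr. Qed.

Lemma dg_ones m i : i < m -> dg t (B ^ m - 1) i = B - 1.
Proof.
move=> lti; rewrite expn_sub1_sum (dg_sum (F := fun=> B - 1)) // => _.
by have := expn2_gt1 t; lia.
Qed.

Lemma dg_unit_digits m i : i < m -> dg t ((B ^ m - 1) %/ (B - 1)) i = 1.
Proof.
move=> lti; rewrite expn_sub1_sum -big_distrr /= mulKn; last first.
  by have := expn2_gt1 t; lia.
rewrite -[RHS](dg_sum (F := fun=> 1) (fun=> expn2_gt1 t) lti).
by congr (dg _ _ _); apply: eq_bigr => j _; rewrite mul1n.
Qed.

Lemma dg_even_mask k i : i < k.*2 ->
  dg t ((B ^ k.*2 - 1) %/ (B + 1)) i = if odd i then 0 else B - 1.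
Proof.
move=> lti; pose F j := if odd j then 0 else B - 1.
have FP j : F j < B by rewrite /F; have := expn2_gt1 t; case: odd; lia.
rewrite -[RHS](dg_sum FP lti).
(* Multiplied by B + 1, the summand of index 2l becomes B ^ (2l + 2) - B ^ (2l), so the sum
   telescopes. *)
suff <- : (\sum_(j < k.*2) F j * B ^ j) * (B + 1) = B ^ k.*2 - 1.
  by rewrite mulnK // addn1.
elim: (k) => [|l IH]; first by rewrite big_ord0.
rewrite doubleS !big_ord_recr /= /F /= odd_double /= mul0n addn0 mulnDl IH.
have p : 0 < B ^ l.*2 by rewrite !expn_gt0.
rewrite !expnS; have := expn2_gt1 t; nia.
Qed.

End LevelDigits.

(** * Terms of the language and their numerical values *)

Lemma ord0_absurd (T : Type) : 'I_0 -> T.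
Proof. by case. Qed.

Definition TZero n : term n := @App n Zero (@ord0_absurd _).
Definition TMinusOne n : term n := @App n MinusOne (@ord0_absurd _).
Definition TOne n : term n := @App n One (@ord0_absurd _).
Definition TLen n : term n := @App n Len (@ord0_absurd _).
(** No arity is imposed on [f]; [app1] is meant for unary symbols and [app2] for binary ones. *)
Definition app1 n f (u : term n) : term n := @App n f (fun=> u).
Definition app2 n f (u v : term n) : term n :=
  @App n f (fun i => if i == 0 :> nat then u else v).

Definition TOr n (u v : term n) :=
  app1 Compl (app2 Cap (app1 Compl u) (app1 Compl v)).

Section EvalVal.

Variables (d n : nat) (e : n.-tuple (M d)).
Local Notation N := (2 ^ 2 ^ d).

Lemma eval_minus_one : eval e (TMinusOne n) = N - 1 :> nat.
Proof. by rewrite /= modn_small // subn1 prednK // expn_gt0. Qed.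

Lemma eval_one : eval e (TOne n) = 1 :> nat.
Proof. by rewrite /= modn_small // expn2_gt1. Qed.

Lemma eval_zero : eval e (TZero n) = 0 :> nat.
Proof. by rewrite /= mod0n. Qed.

Lemma eval_len : eval e (TLen n) = 2 ^ d :> nat.
Proof. by rewrite /= modn_small // ltn_expl. Qed.

Lemma eval_pow u : eval e (app1 Pow u) = minn (2 ^ eval e u) (N - 1) :> nat.
Proof.
rewrite /= tnth_mktuple modn_small //; apply: leq_ltn_trans (geq_minr _ _) _.
by rewrite subn1 prednK // expn_gt0.
Qed.

Lemma eval_compl u :
  eval e (app1 Compl u) = bitcompl (2 ^ d) (eval e u) :> nat.
Proof. by rewrite /= tnth_mktuple modn_small // bitcompl_lt. Qed.

Lemma eval_cap u v :
  eval e (app2 Cap u v) = bitand (2 ^ d) (eval e u) (eval e v) :> nat.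
Proof. by rewrite /= !tnth_mktuple modn_small // bitand_lt. Qed.

Lemma eval_add u v : eval e (app2 Add u v) = (eval e u + eval e v) %% N :> nat.
Proof. by rewrite /= !tnth_mktuple. Qed.

Lemma eval_mul u v : eval e (app2 Mul u v) = (eval e u * eval e v) %% N :> nat.
Proof. by rewrite /= !tnth_mktuple. Qed.

Lemma eval_div u v : eval e (app2 Div u v) = eval e u %/ eval e v :> nat.
Proof.
rewrite /= !tnth_mktuple modn_small //.
exact: leq_ltn_trans (leq_div _ _) (ltn_ord _).
Qed.

End EvalVal.

(** * Terms computing digitwise, for t < d *)

(* z is meant to denote t, and B = 2 ^ 2 ^ t. *)
Section DigitTerms.

Variables (n : nat) (z : term n).

Definition TBase := app1 Pow (app1 Pow z).
(** Subtraction is not in the language; adding -1 replaces it. *)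
Definition TBasePred := app2 Add TBase (TMinusOne n).
(** The repunit 1 + B + ... + B ^ (m - 1), since -1 denotes B ^ m - 1. *)
Definition TUnits := app2 Div (TMinusOne n) TBasePred.
(* (B ^ 2k - 1) / (B + 1) = (B - 1) (1 + B ^ 2 + ... + B ^ (2k - 2)) *)
Definition TEven := app2 Div (TMinusOne n) (app2 Add TBase (TOne n)).
Definition TOdd := app1 Compl TEven.

Definition TAdd (u v : term n) :=
  TOr (app2 Cap (app2 Add (app2 Cap u TEven) (app2 Cap v TEven)) TEven)
      (app2 Cap (app2 Add (app2 Cap u TOdd) (app2 Cap v TOdd)) TOdd).

(** The carry out of an even position i lands at the odd position i + 1, where [TOdd] isolates
    it. *)
Definition TCarry (u v : term n) :=
  app2 Cap (app2 Add (app2 Cap u TEven) (app2 Cap v TEven)) TOdd.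

(* The i-th digit of u exceeds that of v iff u`_i + (B - 1 - v`_i) carries.
   Odd digits are shifted to even positions first, lest the topmost carry be
   lost in the reduction modulo 2 ^ 2 ^ d. *)
Definition TGt (u v : term n) :=
  TOr (app2 Div (TCarry u (app1 Compl v)) TBase)
      (TCarry (app2 Div u TBase) (app2 Div (app1 Compl v) TBase)).

(** Keeping the compared pair apart from the selected pair lets one term serve for both maximum and
    minimum. *)
Definition TSelect (u v x y : term n) :=
  let mask := app2 Mul TBasePred (TGt u v) in
  TOr (app2 Cap x mask) (app2 Cap y (app1 Compl mask)).

Variables (d t : nat) (lt_td : t < d) (e : n.-tuple (M d)).
Hypothesis z_t : eval e z = t :> nat.
Local Notation B := (2 ^ 2 ^ t).
Local Notation m := (2 ^ (d - t)).
Local Notation D u i := (dg t (eval e u) i).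
Let le_td := ltnW lt_td.

Lemma base_lt : B < 2 ^ 2 ^ d.
Proof. by rewrite !ltn_exp2l. Qed.

(** Since t < d, the number m of digits is even. Hence B + 1 divides B ^ m - 1, and the topmost
    digit has odd index. *)
Lemma digit_count_double : m = (2 ^ (d - t).-1).*2.
Proof. by rewrite -mul2n -expnS prednK // subn_gt0. Qed.

Lemma eval_pow_level : eval e (app1 Pow z) = 2 ^ t :> nat.
Proof.
rewrite eval_pow z_t; apply/minn_idPl.
have := ltn_expl (2 ^ d) (isT : 1 < 2); have := ltn_exp2l t d (isT : 1 < 2).
lia.
Qed.

(** This relies on t < d: at t = d the truncation in [Pow] would yield B - 1. *)
Lemma eval_base : eval e TBase = B :> nat.
Proof.
by rewrite eval_pow eval_pow_level; apply/minn_idPl; have := base_lt; lia.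
Qed.

Lemma eval_base_pred : eval e TBasePred = B - 1 :> nat.
Proof.
rewrite eval_add eval_base eval_minus_one.
have Bgt1 := expn2_gt1 t; have := base_lt => ltB.
have -> : B + (2 ^ 2 ^ d - 1) = (B - 1) + 2 ^ 2 ^ d by lia.
by rewrite modnDr modn_small //; lia.
Qed.

Lemma dg_units i : i < m -> D TUnits i = 1.
Proof.
move=> lti; rewrite eval_div eval_minus_one eval_base_pred.
by rewrite (exp2_levels le_td) dg_unit_digits.
Qed.

Lemma dg_even i : i < m -> D TEven i = if odd i then 0 else B - 1.
Proof.
move=> lti; rewrite eval_div eval_minus_one eval_add eval_base eval_one.
(* B + 1 does not wrap around: B + 1 < B ^ 2 <= 2 ^ 2 ^ d, as t + 1 <= d. *)
rewrite modn_small; last first.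
  have B2 : B * B <= 2 ^ 2 ^ d.
    by rewrite -expnD addnn -mul2n -expnS !leq_exp2l.
  by apply: leq_trans B2; have := expn2_gt1 t; nia.
rewrite (exp2_levels le_td) digit_count_double dg_even_mask //.
by rewrite -digit_count_double.
Qed.

Lemma dg_cap u v i :
  i < m -> D (app2 Cap u v) i = bitand (2 ^ t) (D u i) (D v i).
Proof. by move=> lti; rewrite eval_cap dg_bitand. Qed.

Lemma dg_compl u i : i < m -> D (app1 Compl u) i = B - 1 - D u i.
Proof. by move=> lti; rewrite eval_compl dg_bitcompl // bitcomplE // dg_lt. Qed.

Lemma dg_or u v i : i < m -> D (TOr u v) i = bitor (2 ^ t) (D u i) (D v i).
Proof.
move=> lti; rewrite eval_compl dg_bitcompl // dg_cap //.
by rewrite !eval_compl !dg_bitcompl.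
Qed.

Lemma dg_odd i : i < m -> D TOdd i = if odd i then B - 1 else 0.
Proof.
by move=> lti; rewrite dg_compl // dg_even //; case: odd; rewrite ?subn0 ?subnn.
Qed.

Lemma dg_cap_even u i :
  i < m -> D (app2 Cap u TEven) i = if odd i then 0 else D u i.
Proof.
move=> lti; rewrite dg_cap // dg_even //.
by case: odd; rewrite ?bitand0 ?bitand_ones ?dg_lt.
Qed.

Lemma dg_cap_odd u i :
  i < m -> D (app2 Cap u TOdd) i = if odd i then D u i else 0.
Proof.
move=> lti; rewrite dg_cap // dg_odd //.
by case: odd; rewrite ?bitand0 ?bitand_ones ?dg_lt.
Qed.

Lemma dg_div_base u i : D (app2 Div u TBase) i = D u i.+1.
Proof. by rewrite eval_div eval_base dg_div. Qed.

Lemma dg_componentwise_add u v i :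
  i < m -> D (TAdd u v) i = (D u i + D v i) %% B.
Proof.
move=> lti; rewrite dg_or // dg_cap_even // dg_cap_odd // !eval_add !dg_mod //.
have lt_mod : (D u i + D v i) %% B < B by rewrite ltn_pmod // expn_gt0.
(* Only the sum masked with the parity of i survives, and its summands have a zero digit just below
   i. *)
case: ifP => odd_i.
  rewrite dg_add => [|k ik]; last first.
    have ltk : k < m by rewrite ltnW // -ik.
    by move: odd_i; rewrite ik /= !dg_cap_odd // => /negbTE ->.
  by rewrite !dg_cap_odd // odd_i bitorC bitor0.
rewrite dg_add => [|k ik]; last first.
  have ltk : k < m by rewrite ltnW // -ik.
  by move: odd_i; rewrite ik /= !dg_cap_even // => /negbFE ->.
by rewrite !dg_cap_even // odd_i bitor0.
Qed.

Lemma dg_carries u v i : i.+1 < m ->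
  D (TCarry u v) i.+1 = if odd i then 0 else (D u i + D v i) %/ B.
Proof.
move=> ltSi; have lti := ltnW ltSi.
rewrite dg_cap_odd // oddS if_neg; case: ifP => // odd_i.
rewrite eval_add dg_mod // dg_carry => [|k ik||].
- by rewrite !dg_cap_even // odd_i.
- have ltk : k < m by rewrite ltnW // -ik.
  by move: odd_i; rewrite ik /= !dg_cap_even // => /negbFE ->.
- by rewrite dg_cap_even // oddS odd_i.
- by rewrite dg_cap_even // oddS odd_i.
Qed.

Lemma dg_gt u v i : i < m -> D (TGt u v) i = (D v i < D u i).
Proof.
move=> lti; have Bgt1 := expn2_gt1 t.
have cmp j : j < m ->
    (D u j + D (app1 Compl v) j) %/ B = (D v j < D u j).
  move=> ltj; rewrite dg_compl //; have := dg_lt t (eval e u) j.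
  have := dg_lt t (eval e v) j; move: (D u j) (D v j) => a b ltb lta.
  case: ltnP => h; last by apply: divn_small; lia.
  have -> : a + (B - 1 - b) = 1 * B + (a - 1 - b) by lia.
  by rewrite divnMDl ?divn_small //; lia.
have cmp_lt : (D v i < D u i) < B by apply: leq_ltn_trans (leq_b1 _) Bgt1.
rewrite dg_or // dg_div_base; case: (boolP (odd i)) => odd_i.
  have -> : D (TCarry u (app1 Compl v)) i.+1 = 0.
    (* If i is the topmost position, then i + 1 lies beyond all digits. *)
    have [ltSi|] := ltnP i.+1 m; first by rewrite dg_carries // odd_i.
    by move=> leSi; rewrite (dg_out le_td).
  case: i lti odd_i cmp_lt => // i lti /= odd_i cmp_lt.
  by rewrite dg_carries // (negbTE odd_i) !dg_div_base cmp // bitorC bitor0.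
(* Both i and m are even, so i is not the topmost position. *)
have ltSi : i.+1 < m.
  by rewrite ltn_neqAle lti andbT; apply: contra odd_i => /eqP/(congr1 odd);
    rewrite digit_count_double odd_double /= => /negbFE.
rewrite dg_carries // (negbTE odd_i) cmp // dg_cap_odd // (negbTE odd_i).
by rewrite bitor0.
Qed.

Lemma dg_select u v x y i : i < m ->
  D (TSelect u v x y) i = if D v i < D u i then D x i else D y i.
Proof.
move=> lti; have Bgt1 := expn2_gt1 t.
have mask_i : D (app2 Mul TBasePred (TGt u v)) i =
    if D v i < D u i then B - 1 else 0.
  rewrite eval_mul dg_mod // eval_base_pred dg_scale.
    by rewrite dg_gt //; case: ltnP; rewrite ?muln1 ?muln0.
  (* [dg_scale] also asks about positions beyond the top, where the digits are zero. *)
  move=> j; have [ltj|lej] := ltnP j m.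
    by rewrite dg_gt //; case: ltnP; rewrite ?muln1 ?muln0; lia.
  suff -> : D (TGt u v) j = 0 by rewrite muln0; lia.
  by rewrite (dg_out le_td).
rewrite dg_or // !dg_cap // dg_compl // mask_i.
case: ltnP => _; first by rewrite subnn bitand0 bitand_ones ?bitor0 ?dg_lt.
by rewrite subn0 bitand0 bitand_ones ?dg_lt // bitorC bitor0 ?dg_lt.
Qed.

End DigitTerms.

(** * From representing terms to formulas *)

(** The free variables are ordered as in the theorem: the arguments, then y for the value, then z
    for the level. *)
Definition level_var k : 'I_(k + 2) := rshift k ord_max.
Definition value_var k : 'I_(k + 2) := rshift k ord0.
Definition arg_var k (i : 'I_k) : 'I_(k + 2) := lshift 2 i.

Definition env d k (a : k.-tuple (M d)) (b : M d) (t : nat) :=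
  [tuple of a ++ [:: b; inM d t]].

Lemma tnth_level_var d k (a : k.-tuple (M d)) b t :
  tnth (env a b t) (level_var k) = inM d t.
Proof. by rewrite tnth_rshift. Qed.

Lemma tnth_value_var d k (a : k.-tuple (M d)) b t :
  tnth (env a b t) (value_var k) = b.
Proof. by rewrite tnth_rshift. Qed.

Lemma tnth_arg_var d k (a : k.-tuple (M d)) b t i :
  tnth (env a b t) (arg_var i) = tnth a i.
Proof. by rewrite tnth_lshift. Qed.

(** Level t = d is left out because B is then too large to be an element of [M d];
    [definable_of_term] treats it separately. *)
Definition represents f (u : term (arity f + 2)) :=
  forall d t, t < d -> forall (a : (arity f).-tuple (M d)) b,
  forall i, i < 2 ^ (d - t) ->
    dg t (eval (env a b t) u) i =
    interp f [tuple digit t (tnth a j) i | j < arity f] :> nat.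

(** At t = d each number is its own single digit. *)
Lemma componentwise_top d f (a : (arity f).-tuple (M d)) :
  componentwise d f a = interp f a.
Proof.
apply/componentwiseP => //; apply/forallP => -[i /=]; rewrite subnn.
case: i => // _.
have digit0 (x : M d) : digit d x 0 = x.
  by apply: val_inj; rewrite /= mul0n divn1 modn_small.
rewrite digit0; apply/eqP; congr (interp f _).
by apply: eq_from_tnth => j; rewrite tnth_mktuple digit0.
Qed.

(** For t <= d the equation p(z) = n holds exactly when t = d. This quantifier-free test lets one
    formula use [f] itself at the top level and [u] below it. *)
Lemma definable_of_term f (u : term (arity f + 2)) : represents u ->
  exists2 psi : formula (arity f + 2), existential psi &
    forall d t : nat, t <= d ->
    forall (a : (arity f).-tuple (M d)) (b : M d),
      componentwise t f a = b <-> holds [tuple of a ++ [:: b; inM d t]] psi.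
Proof.
move=> u_f; pose k := arity f.
pose top := FEq (app1 Pow (Var (level_var k))) (TLen (k + 2)).
pose val_eq v := FEq v (Var (value_var k)).
exists (FOr (FAnd top (val_eq (App (fun i => Var (arg_var i)))))
            (FAnd (FNot top) (val_eq u))) => // d t le_td a b.
rewrite -/(env a b t) /=.
set E := _ = inM d (2 ^ d); rewrite tnth_value_var.
have topP : E <-> t = d.
  have -> : E = (eval (env a b t) (app1 Pow (Var (level_var k))) =
                 eval (env a b t) (TLen _)) by [].
  have valP : eval (env a b t) (app1 Pow (Var (level_var k))) = 2 ^ t :> nat.
    rewrite eval_pow [eval _ _]tnth_level_var inM_level //; apply/minn_idPl.
    have := ltn_expl (2 ^ d) (isT : 1 < 2).
    have := leq_exp2l t d (isT : 1 < 2); lia.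
  split=> [/(congr1 val) pz_len|td].
    have /eqP : 2 ^ t = 2 ^ d by rewrite -valP -[RHS](eval_len (env a b t)).
    by rewrite eqn_exp2l // => /eqP.
  by apply: val_inj; rewrite [LHS]valP td; symmetry; exact: eval_len.
have -> : [tuple tnth (env a b t) (arg_var i) | i < arity f] = a.
  by apply: eq_from_tnth => i; rewrite tnth_mktuple tnth_arg_var.
have [td|ne_td] := eqVneq t d.
  rewrite {1}td componentwise_top; tauto.
have lt_td : t < d by rewrite ltn_neqAle ne_td.
have -> : componentwise t f a = eval (env a b t) u.
  apply/componentwiseP => //; apply/forallP => i; apply/eqP/val_inj.
  by rewrite -[RHS]/(dg t _ i) u_f.
by split=> [->|[[/topP/eqP]|[]//]]; [right; split=> // /topP/eqP|];
  rewrite (negbTE ne_td).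
Qed.

(** * Representing terms for the individual symbols *)

Section Symbols.

Local Notation z k := (Var (level_var k)).
Local Notation x := (Var (@arg_var 2 ord0)).
Local Notation y := (Var (@arg_var 2 ord_max)).

Let zP d t k (a : k.-tuple (M d)) b :
  t < d -> eval (env a b t) (z k) = t :> nat.
Proof. by move=> lt_td; rewrite /= tnth_level_var inM_level // ltnW. Qed.

Let argP d t k (a : k.-tuple (M d)) b j i :
  dg t (eval (env a b t) (Var (arg_var j))) i = digit t (tnth a j) i.
Proof. by rewrite [eval _ _]tnth_arg_var. Qed.

Lemma zero_represented : represents (f := Zero) (TZero (arity Zero + 2)).
Proof. by move=> d t lt_td a b i lti; rewrite eval_zero dgE div0n. Qed.

Lemma one_represented : represents (f := One) (TUnits (z 0)).
Proof.
move=> d t lt_td a b i lti.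
by rewrite (dg_units lt_td) ?zP //= modn_small // expn2_gt1.
Qed.

Lemma minus_one_represented :
  represents (f := MinusOne) (TMinusOne (arity MinusOne + 2)).
Proof.
move=> d t lt_td a b i lti; rewrite eval_minus_one /=.
rewrite (exp2_levels (ltnW lt_td)) dg_ones // modn_small //.
by rewrite subn1 prednK // expn_gt0.
Qed.

(** Each digit must be 2 ^ t, the value of n in [M t], rather than 2 ^ d. As 2 ^ t < B, scaling the
    repunit by p(z) causes no carry. *)
Lemma len_represented :
  represents (f := Len) (app2 Mul (app1 Pow (z 0)) (TUnits (z 0))).
Proof.
move=> d t lt_td a b i lti; have le_td := ltnW lt_td.
rewrite eval_mul dg_mod // (eval_pow_level lt_td) ?zP //.
have T_lt : 2 ^ t < 2 ^ 2 ^ t by rewrite ltn_expl.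
rewrite dg_scale => [|j]; last first.
  have [ltj|lej] := ltnP j (2 ^ (d - t)).
    by rewrite (dg_units lt_td) ?zP // muln1.
  by rewrite (dg_out le_td) ?muln0 ?expn_gt0.
by rewrite (dg_units lt_td) ?zP // muln1 /= modn_small.
Qed.

(** A bitwise operation ignores how bits are grouped into digits, so the symbol represents itself;
    the same holds for [Cap]. *)
Lemma compl_represented :
  represents (f := Compl) (app1 Compl (Var (@arg_var 1 ord0))).
Proof.
move=> d t lt_td a b i lti; rewrite [LHS]dg_compl ?argP //=.
by rewrite tnth_mktuple [RHS]modn_small ?bitcompl_lt // bitcomplE.
Qed.

Lemma add_represented : represents (f := Add) (TAdd (z 2) x y).
Proof.
move=> d t lt_td a b i lti.
by rewrite dg_componentwise_add ?zP // !argP /= !tnth_mktuple.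
Qed.

Lemma max_represented : represents (f := Max) (TSelect (z 2) x y x y).
Proof.
move=> d t lt_td a b i lti.
rewrite dg_select ?zP // !argP /= !tnth_mktuple /= [RHS]modn_small.
  by rewrite /maxn; case: ltngtP.
by rewrite gtn_max !ltn_pmod ?expn_gt0.
Qed.

Lemma min_represented : represents (f := Min) (TSelect (z 2) x y y x).
Proof.
move=> d t lt_td a b i lti.
rewrite dg_select ?zP // !argP /= !tnth_mktuple /= [RHS]modn_small.
  by rewrite /minn; case: ltngtP.
by rewrite gtn_min ltn_pmod ?expn_gt0.
Qed.

Lemma cap_represented : represents (f := Cap) (app2 Cap x y).
Proof.
move=> d t lt_td a b i lti.
rewrite dg_cap // !argP /= !tnth_mktuple [RHS]modn_small //.
exact: bitand_lt.
Qed.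

End Symbols.

Theorem theorem6 (f : symbol) (hMul : f <> Mul) (hDiv : f <> Div) (hPow : f <> Pow) :
  exists2 psi : formula (arity f + 2), existential psi &
    forall d t : nat, t <= d ->
    forall (a : (arity f).-tuple (M d)) (b : M d),
      componentwise t f a = b <-> holds [tuple of a ++ [:: b; inM d t]] psi.
Proof.
case: f hMul hDiv hPow => // _ _ _.
- exact: definable_of_term zero_represented.
- exact: definable_of_term one_represented.
- exact: definable_of_term minus_one_represented.
- exact: definable_of_term len_represented.
- exact: definable_of_term compl_represented.
- exact: definable_of_term add_represented.
- exact: definable_of_term max_represented.
- exact: definable_of_term min_represented.
- exact: definable_of_term cap_represented.
Qed.
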